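(* Let $\mathbb{K}$ be a field, $\frac12\le s<1$, and $d=\lceil sn\rceil<n$. Then for every fixed $0<p<1$, $$\mathbb{P}\big(Y\in Y_d(n,p): A_Y\text{ fails the WLP}\big)\ \ge\ \mathbb{P}\big(Y\in Y_d(n,p): \tilde H_d(Y;\mathbb{K})\neq0\big).$$
   Context: For $d\ge1$, $Y_d(n,p)$ is the probability space of simplicial complexes $Y$ on vertex set $[n]$ with $\Delta_n^{(d-1)}\subseteq Y\subseteq\Delta_n^{(d)}$, where $\Delta_n^{(k)}$ is the complex of all subsets of $[n]$ of size at most $k+1$, with $\mathbb{P}(Y)=p^{f_d}(1-p)^{\binom{n}{d+1}-f_d}$, $f_d$ being the number of $d$-dimensional faces of $Y$ (i.e. each $d$-face is included independently with probability $p$). $A_Y=\mathbb{K}[x_1,\dots,x_n]/(I_Y+(x_1^{d+2},\dots,x_n^{d+2}))$, where $I_Y$ is the Stanley–Reisner ideal of $Y$. An artinian graded algebra $A$ with top nonzero degree $D$ has the weak Lefschetz property (WLP) if there is a linear form $\ell$ with $\times\ell:A_i\to A_{i+1}$ of full rank for all $i<D$. *)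

(* Defs.v *)
From HB Require Import structures.
From mathcomp Require Import all_boot all_order all_algebra.
From mathcomp Require Import reals.
From mathcomp Require Import mpoly.
From Stdlib Require Import ClassicalEpsilon.
Set Implicit Arguments. Unset Strict Implicit. Unset Printing Implicit Defensive.
Import Order.TTheory GRing.Theory Num.Theory.
Local Open Scope ring_scope.

(* A complex Y with Delta^(d-1) <= Y <= Delta^(d) on vertex set 'I_n is
   determined by its set F of d-dimensional faces (subsets of size d+1). *)
Definition dfaces (n d : nat) : {set {set 'I_n}} := [set s : {set 'I_n} | #|s| == d.+1].

Definition is_face (n d : nat) (F : {set {set 'I_n}}) (s : {set 'I_n}) : bool :=
  (#|s| <= d)%N || (s \in F).

Definition asb (P : Prop) : bool :=
  if excluded_middle_informative P then true else false.

(* P(Y in E) for Y in Y_d(n,p): each d-face included independently w.p. p *)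
Definition probY (R : realType) (n d : nat) (p : R)
  (E : {set {set 'I_n}} -> Prop) : R :=
  \sum_(F : {set {set 'I_n}} | (F \subset dfaces n d) && asb (E F))
     p ^+ #|F| * (1 - p) ^+ ('C(n, d.+1) - #|F|).

Definition xmon (K : fieldType) (n : nat) (s : {set 'I_n}) : {mpoly K[n]} :=
  \prod_(i in s) 'X_i.

Definition genAY (K : fieldType) (n d : nat) (F : {set {set 'I_n}})
  (g : {mpoly K[n]}) : Prop :=
  (exists s : {set 'I_n}, ~~ is_face d F s /\ g = xmon K s)
  \/ (exists i : 'I_n, g = 'X_i ^+ d.+2).

Definition in_ideal (K : fieldType) (n : nat) (G : {mpoly K[n]} -> Prop)
  (f : {mpoly K[n]}) : Prop :=
  exists l : seq ({mpoly K[n]} * {mpoly K[n]}),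
    (forall x, x \in l -> G x.2) /\
    f = \big[+%R/0]_(x <- l) (x.1 * x.2).

Definition IAY (K : fieldType) (n d : nat) (F : {set {set 'I_n}})
  (f : {mpoly K[n]}) : Prop := in_ideal (genAY (K := K) d F) f.

(* Generic notions for a graded quotient A = K[x]/I by a homogeneous ideal I,
   with A_i = (homogeneous polynomials of degree i) / (I in degree i). *)
Definition deg_nonzero (K : fieldType) (n : nat) (I : {mpoly K[n]} -> Prop)
  (i : nat) : Prop :=
  exists f : {mpoly K[n]}, f \is i.-homog /\ ~ I f.

Definition top_degree (K : fieldType) (n : nat) (I : {mpoly K[n]} -> Prop)
  (D : nat) : Prop :=
  deg_nonzero I D /\ (forall j, (D < j)%N -> ~ deg_nonzero I j).

Definition mul_full_rank (K : fieldType) (n : nat) (I : {mpoly K[n]} -> Prop)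
  (l : {mpoly K[n]}) (i : nat) : Prop :=
  (forall f : {mpoly K[n]}, f \is i.-homog -> I (l * f) -> I f)
  \/ (forall g : {mpoly K[n]}, g \is i.+1.-homog ->
        exists f : {mpoly K[n]}, f \is i.-homog /\ I (g - l * f)).

Definition WLP (K : fieldType) (n : nat) (I : {mpoly K[n]} -> Prop) : Prop :=
  exists D : nat, top_degree I D /\
    exists l : {mpoly K[n]}, l \is 1.-homog /\
      forall i, (i < D)%N -> mul_full_rank I l i.

Definition pos (n : nat) (s : {set 'I_n}) (v : 'I_n) : nat :=
  #|[set u in s | (u < v)%N]|.

(* boundary of a d-chain c (coefficients on the d-faces) evaluated at t:
   d[v_0,...,v_d] = sum_j (-1)^j [v_0,..,^v_j,..,v_d] *)
Definition boundary (K : fieldType) (n : nat) (c : {set 'I_n} -> K)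
  (F : {set {set 'I_n}}) (t : {set 'I_n}) : K :=
  \big[+%R/0]_(v : 'I_n | v \notin t)
     (if (v |: t) \in F then (-1) ^+ pos (v |: t) v * c (v |: t) else 0).

(* Y has no (d+1)-faces, so H~_d(Y;K) = ker (boundary_d : C_d -> C_(d-1)) *)
Definition Hd_nonzero (K : fieldType) (n d : nat) (F : {set {set 'I_n}}) : Prop :=
  exists c : {set 'I_n} -> K,
    (forall s, s \notin F -> c s = 0) /\ (exists s, c s != 0) /\
    (forall t : {set 'I_n}, #|t| = d -> boundary c F t = 0).

(* Main.v *)
(** A nonzero d-cycle c of Y gives a nonzero functional on A_N, where
    N = (d+1)(d+2)/2: send a monomial whose support is a d-face s and whose
    exponents are a permutation of 1, ..., d+1 to c(s) times the sign of the
    permutation, and all other monomials to 0. It kills the multiples of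
    x_1 + ... + x_n: lowering an exponent k > 1 by one produces two equal
    exponents, whose contributions cancel by antisymmetry, and lowering the
    exponent 1 produces the boundary of c. A torus rescaling (with a limit when
    some coefficients vanish) treats an arbitrary linear form, so multiplication
    A_(N-1) -> A_N is never surjective.

    It is not injective either, since dim A_(N-1) >= dim A_N. Let h_k(i) be the
    coefficient of t^i in (t + ... + t^(d+1))^k, a symmetric unimodal sequence
    centred at k(d+2)/2. The supports of size < d contribute at least as much
    to A_(N-1) as to A_N, and symmetry gives
    h_(d+1)(N) - h_(d+1)(N-1) = h_d(N-1) - h_d(N), so that the loss on the
    d-faces is compensated by the (d-1)-faces, because
    'C(n, d+1) <= 'C(n, d) when n <= 2d+1. *)
Require Import Defs.
From HB Require Import structures.
From mathcomp Require Import all_boot all_order all_algebra.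
From mathcomp Require Import reals.
From mathcomp Require Import mpoly.
From mathcomp Require Import zify lra.
Import Order.TTheory GRing.Theory Num.Theory.
Local Open Scope ring_scope.
Set Implicit Arguments. Unset Strict Implicit. Unset Printing Implicit Defensive.

Lemma asbP (P : Prop) : reflect P (asb P).
Proof. by rewrite /asb; case: ClassicalEpsilon.excluded_middle_informative => p; constructor. Qed.

(** * Bounded compositions: symmetry and unimodality *)

(* Number of k-tuples in {1, ..., d+1} with sum x; the integer argument makes
   it vanish at negative x, where truncated subtraction would not. *)
Fixpoint ncomp (d k : nat) (x : int) : nat :=
  if k is k'.+1 then (\sum_(j < d.+1) ncomp d k' (x - j.+1%:Z))%N else x == 0.

Lemma ncomp_neg d k x : x < 0 -> ncomp d k x = 0%N.
Proof.
elim: k x => [|k IHk] x x0 /=; first by rewrite lt_eqF.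
by rewrite big1 // => j _; rewrite IHk //; lia.
Qed.

(** Replace every part j by d + 2 - j. *)
Lemma ncomp_sym d k x : ncomp d k ((k * d.+2)%:Z - x) = ncomp d k x.
Proof.
elim: k x => [|k IHk] x /=; first by congr nat_of_bool; apply/eqP/eqP; lia.
rewrite (reindex_inj rev_ord_inj) /=; apply: eq_bigr => j _.
rewrite -[RHS]IHk; congr ncomp.
by have := ltn_ord j; lia.
Qed.

(** Both [ncomp d k.+1] values sum [ncomp d k] over d + 1 consecutive arguments; the two windows
    differ only in their end terms. *)
Lemma ncomp_step d k x :
  (ncomp d k.+1 (x + 1) + ncomp d k (x - d.+1%:Z) = ncomp d k.+1 x + ncomp d k x)%N.
Proof.
rewrite /= big_ord_recl [in RHS]big_ord_recr /= addrK [in RHS]addnAC.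
rewrite [(ncomp d k x + _)%N]addnC; congr (_ + _ + _)%N.
by apply: eq_bigr => j _; congr ncomp; rewrite /bump /=; lia.
Qed.

(** The hypotheses place y to the right of the centre k(d + 2)/2, at least as far from it as x. A
    unit step away from the centre reduces, by [ncomp_step], to the claim for one part fewer. *)
Lemma ncomp_mono d k x y :
  x <= y -> (k * d.+2)%:Z <= x + y -> (ncomp d k y <= ncomp d k x)%N.
Proof.
elim: k x y => [|k IHk] x y xy kxy.
  by rewrite /=; case: (y =P 0) => // y0; rewrite (_ : x = 0) //; lia.
have step z : (k.+1 * d.+2)%:Z <= z + z + 1 ->
    (ncomp d k.+1 (z + 1) <= ncomp d k.+1 z)%N.
  move=> kz; have := ncomp_step d k z.
  have : (ncomp d k z <= ncomp d k (z - d.+1%:Z))%N by apply: IHk; nia.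
  move: (ncomp d k _) (ncomp d k _) (ncomp d k.+1 _) (ncomp d k.+1 _); lia.
have chain (m : nat) z : (k.+1 * d.+2)%:Z <= z + z + 1 ->
    (ncomp d k.+1 (z + m%:Z) <= ncomp d k.+1 z)%N.
  elim: m => [|m IHm] kz; first by rewrite addr0.
  apply: leq_trans (IHm kz); rewrite (_ : z + _ = z + m%:Z + 1);
    by [apply: step; lia | lia].
(* Right of the centre, unit steps lead from x to y; otherwise they start at the mirror image of x,
   which is at most y. *)
have [kx|kx] := leP (k.+1 * d.+2)%:Z (x + x + 1).
  by rewrite (_ : y = x + `|y - x|%N%:Z); [exact: chain | lia].
rewrite -(ncomp_sym _ _ x).
set z := _ - x; rewrite (_ : y = z + `|y - z|%N%:Z); last by rewrite /z; lia.
by apply: chain; rewrite /z; lia.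
Qed.

(** * Counting the monomials of A_Y by support *)

(** Exponents in ['I_d.+2] make the monomials divisible by no x_i^(d+2) a finite type. *)
Definition mset (n d : nat) (u : {ffun 'I_n -> 'I_d.+2}) : {set 'I_n} :=
  [set i | u i != ord0].

Definition msum (n d : nat) (u : {ffun 'I_n -> 'I_d.+2}) : nat := (\sum_i u i)%N.

Lemma coef_ncomp d k i :
  ((\sum_(j < d.+1) 'X^(j.+1) : {poly int}) ^+ k)`_i = (ncomp d k i)%:R.
Proof.
elim: k i => [|k IHk] i; first by rewrite expr0 coef1.
rewrite exprS mulr_suml coef_sum /= natr_sum; apply: eq_bigr => j _.
rewrite coefXnM; case: ltnP => ij; first by rewrite ncomp_neg //; lia.
by rewrite IHk subzn.
Qed.

(** The generating function is a product over all variables, with factor t + ... + t^(d+1) for v in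
    s and 1 otherwise; expanding it gives one term t^(msum u) for each u of support s. *)
Lemma card_mset n d (s : {set 'I_n}) i :
  #|[set u : {ffun 'I_n -> 'I_d.+2} | (mset u == s) && (msum u == i)]|
    = ncomp d #|s| i.
Proof.
apply/eqP; rewrite -(eqr_nat int) -coef_ncomp; apply/eqP.
pose P (v : 'I_n) := [pred j : 'I_d.+2 | (j != ord0) == (v \in s)].
have -> : (\sum_(j < d.+1) 'X^(j.+1) : {poly int}) ^+ #|s|
    = \prod_(v : 'I_n) \sum_(j in P v) 'X^j.
  rewrite -prodr_const [RHS](bigID (mem s)) /= [X in _ * X]big1 ?mulr1.
    apply: eq_bigr => v vs; rewrite [RHS]big_mkcond [RHS]big_ord_recl /=.
    rewrite !inE vs /= add0r; apply: eq_bigr => j _.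
    by rewrite !inE vs.
  move=> v /negPf vs; rewrite (big_pred1 ord0) ?expr0 // => j.
  by rewrite !inE vs /= eqbF_neg negbK.
rewrite bigA_distr_big_dep coef_sum -sum1_card natr_sum.
rewrite [LHS]big_mkcond [RHS]big_mkcond /=; apply: eq_bigr => u _.
rewrite inE -expr_sum coefXn.
have -> : (u \in family P) = (mset u == s).
  apply/familyP/eqP => [us|us v]; last by rewrite !inE -us inE.
  by apply/setP => v; have := us v; rewrite !inE => /eqP.
by rewrite (eq_sym i) -/(msum u); do 2!case: eqP.
Qed.

Lemma leq_bin_half n d : (n <= d.*2.+1)%N -> ('C(n, d.+1) <= 'C(n, d))%N.
Proof.
move=> nd; rewrite -(leq_pmul2l (ltn0Sn d)) mul_bin_left.
by rewrite leq_mul2r; apply/orP; right; lia.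
Qed.

Definition face_monos (n d : nat) (F : {set {set 'I_n}}) (i : nat) :
  {set {ffun 'I_n -> 'I_d.+2}} :=
  [set u : {ffun 'I_n -> 'I_d.+2} | is_face d F (mset u) && (msum u == i)].

Lemma card_face_monos n d (F : {set {set 'I_n}}) i : F \subset dfaces n d ->
  #|face_monos d F i| =
    (\sum_(s : {set 'I_n} | (#|s| < d)%N) ncomp d #|s| i
     + ('C(n, d) * ncomp d d i + #|F| * ncomp d d.+1 i))%N.
Proof.
move=> /subsetP FD.
have -> : #|face_monos d F i| = (\sum_(s | is_face d F s) ncomp d #|s| i)%N.
  rewrite -sum1_card (partition_big (@mset n d) (is_face d F)) /=; last first.
    by move=> u; rewrite inE => /andP[].
  apply: eq_bigr => s sF; rewrite -card_mset -sum1_card; apply: eq_bigl => u.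
  by rewrite !inE; case: (mset u =P s) => [->|_]; rewrite ?sF ?andbT ?andbF.
rewrite (bigID (fun s : {set 'I_n} => #|s| < d)%N) /=; congr (_ + _)%N.
  by apply: eq_bigl => s; rewrite /is_face; case: ltnP => [/ltnW ->|]; rewrite ?andbF.
rewrite (bigID (mem F)) /= addnC; congr (_ + _)%N.
  have <- : #|[set s : {set 'I_n} | #|s| == d]| = 'C(n, d).
    by rewrite card_draws card_ord.
  rewrite -sum_nat_const; apply: eq_big => s.
    rewrite /is_face !inE -leqNgt eqn_leq.
    case sF: (s \in F); rewrite ?orbF ?andbT ?andbF //.
    by have := FD _ sF; rewrite inE => /eqP ->; rewrite ltnn.
  rewrite /is_face -leqNgt => /andP[/andP[/orP[sd|->//] ds] _].
  by congr ncomp; apply/eqP; rewrite eqn_leq sd.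
rewrite -sum_nat_const; apply: eq_big => s.
  rewrite /is_face; case sF: (s \in F); rewrite ?orbT ?andbF //=.
  by have := FD _ sF; rewrite inE -leqNgt => /eqP ->; rewrite leqnSn.
by move=> /andP[_ /FD]; rewrite inE => /eqP ->.
Qed.

Lemma leq_card_face_monos n d (F : {set {set 'I_n}}) N :
  F \subset dfaces n d -> (n <= d.*2.+1)%N -> (N.+1.*2 = d.+1 * d.+2)%N ->
  (#|face_monos d F N.+1| <= #|face_monos d F N|)%N.
Proof.
move=> FD nd hN; rewrite !card_face_monos //; apply: leq_add.
  by apply: leq_sum => s sd; apply: ncomp_mono; [lia | nia].
have cF : (#|F| <= 'C(n, d))%N.
  apply: leq_trans (leq_bin_half nd); apply: leq_trans (subset_leq_card FD) _.
  by rewrite /dfaces card_draws card_ord.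
have hd : (ncomp d d N.+1 <= ncomp d d N)%N by apply: ncomp_mono; [lia | nia].
have := ncomp_step d d N; rewrite (_ : N%:Z + 1 = N.+1); last by lia.
(* Reflection in d(d + 2)/2 sends N - (d + 1) to N + 1, because 2(N + 1) = (d + 1)(d + 2). *)
rewrite -[ncomp d d (_ - _)]ncomp_sym.
rewrite (_ : _ - (_ - _) = N.+1%:Z); last by nia.
move: cF hd; nia.
Qed.

(** * Signs of exponent vectors *)

(* Inversions of the exponent vector restricted to its support. *)
Definition minv (n : nat) (m : 'X_{1..n}) : nat :=
  (\sum_(u < n) \sum_(v < n) ((u < v) && (m v < m u) && (0 < m v)))%N.

Definition msup (n : nat) (m : 'X_{1..n}) : {set 'I_n} := [set i | m i != 0%N].

Lemma mnmDU n (m : 'X_{1..n}) i j : (m + U_(i))%MM j = (m j + (i == j))%N.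
Proof. by rewrite mnmDE mnm1E. Qed.

Lemma msupDU n (m : 'X_{1..n}) i : msup (m + U_(i)) = i |: msup m.
Proof.
by apply/setP => v; rewrite !inE mnmDU addn_eq0 negb_and orbC eqb0 negbK eq_sym.
Qed.

Lemma msupDU_id n (m : 'X_{1..n}) i : (0 < m i)%N -> msup (m + U_(i)) = msup m.
Proof. by move=> mi; rewrite msupDU; apply/setUidPr; rewrite sub1set inE -lt0n. Qed.

(** The pair (i, j) is an inversion only when i is raised. All other comparisons agree, since no
    other exponent equals k = [m i] or k + 1. *)
Lemma minv_swap n (m : 'X_{1..n}) (i j : 'I_n) :
  (i < j)%N -> m i = m j -> (0 < m i)%N ->
  (forall v, v != i -> v != j -> m v != m i /\ m v != (m i).+1) ->
  minv (m + U_(i)) = (minv (m + U_(j))).+1.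
Proof.
move=> ij mij mi0 H.
have ij' : i != j by rewrite -val_eqE /=; lia.
rewrite /minv !pair_bigA (bigD1 (i, j)) //= [in RHS](bigD1 (i, j)) //= -addSn.
congr (_ + _)%N.
  by rewrite !mnmDU ij !eqxx (eq_sym j i) (negPf ij') mij; lia.
apply: eq_bigr => -[u v]; rewrite xpair_eqE /= => uv; rewrite !mnmDU.
have Hu := H u; have Hv := H v; move: uv.
case: (eqVneq u v) => [->|]; first by rewrite ltnn.
rewrite !(eq_sym i) !(eq_sym j).
case: (eqVneq u i) => [?|ui]; case: (eqVneq v i) => [?|vi];
  case: (eqVneq u j) => [?|uj]; case: (eqVneq v j) => [?|vj] //= *; subst;
  rewrite ?eqxx // in ij' *; congr nat_of_bool; try lia;
  try (have [/eqP h1 /eqP h2] := Hu ui uj);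
  try (have [/eqP h3 /eqP h4] := Hv vi vj); lia.
Qed.

(** The new exponent 1 is below all other positive exponents, so it forms an inversion exactly with
    each support vertex before j: this is the sign in the boundary. *)
Lemma minv_new n (m : 'X_{1..n}) (j : 'I_n) :
  m j = 0%N -> (forall v, m v != 1%N) ->
  minv (m + U_(j)) = (minv m + pos (j |: msup m) j)%N.
Proof.
move=> mj0 H; rewrite /minv /pos.
have -> : #|[set u in j |: msup m | (u < j)%N]|
   = (\sum_(u < n) \sum_(v < n) ((v == j) && (u \in msup m) && (u < v)))%N.
  rewrite -sum1_card big_mkcond /=; apply: eq_bigr => u _.
  rewrite (bigD1 j) //= big1 ?addn0; last by move=> v /negPf ->.
  rewrite eqxx !inE; case: eqP => [->|_] /=; last by case: (_ && _).
  by rewrite mj0 ltnn.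
rewrite -big_split /=; apply: eq_bigr => u _.
rewrite -big_split /=; apply: eq_bigr => v _.
rewrite !mnmDU inE (eq_sym v j).
have /eqP Hu := H u; have /eqP Hv := H v.
case: (eqVneq j v) => [jv|_] /=; case: (eqVneq j u) => [ju|_] /=.
- by rewrite -ju -jv ltnn /= andbF.
- by rewrite -jv mj0; lia.
- by rewrite -ju mj0; lia.
- by rewrite !addn0.
Qed.

(** * The functional attached to a cycle *)

Section Cycle.
Variables (K : fieldType) (n d : nat) (F : {set {set 'I_n}}) (c : {set 'I_n} -> K).
Hypothesis FD : F \subset dfaces n d.
Hypothesis cyc : forall t : {set 'I_n}, #|t| = d -> boundary c F t = 0.

(** Being distinct and at most d + 1, the exponents on the d + 1 support vertices form a permutation
    of 1, ..., d + 1. *)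
Definition bij_mono (m : 'X_{1..n}) : bool :=
  [&& msup m \in F, [forall i, m i <= d.+1]%N &
      [forall i, forall j, (m i == m j) && (0 < m i)%N ==> (i == j)]].

Definition wgt (m : 'X_{1..n}) : K :=
  if bij_mono m then (-1) ^+ minv m * c (msup m) else 0.

Lemma bij_monoP m : reflect
  [/\ msup m \in F, forall i, (m i <= d.+1)%N &
      forall i j, m i = m j -> (0 < m i)%N -> i = j] (bij_mono m).
Proof.
apply: (iffP and3P) => [[mF /forallP md /'forall_forallP mi]|[mF md mi]].
  split=> // i j /eqP mij mi0; apply/eqP.
  by have := mi i j; rewrite mij mi0.
split=> //; first by apply/forallP.
apply/'forall_forallP => i j; apply/implyP => /andP[/eqP mij mi0].
by apply/eqP; apply: mi.
Qed.

Lemma bij_mono_onto m k : bij_mono m -> (0 < k <= d.+1)%N -> exists i, m i = k.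
Proof.
move=> /bij_monoP[mF md mi] /andP[k0 kd].
pose f (i : 'I_n) : 'I_d.+1 := inord (m i).-1.
have fi : {in msup m &, injective f}.
  move=> i j; rewrite !inE => i0 j0 /(congr1 (@nat_of_ord _)).
  have := md i; have := md j => mjd mid.
  rewrite !inordK; try lia.
  by move=> e; apply: mi; lia.
have cf : f @: msup m = [set: 'I_d.+1].
  apply/eqP; rewrite eqEcard subsetT cardsT card_ord card_in_imset //.
  by have := subsetP FD _ mF; rewrite inE => /eqP ->; rewrite leqnn.
have : (inord k.-1 : 'I_d.+1) \in f @: msup m by rewrite cf inE.
move=> /imsetP[i]; rewrite inE => i0 /(congr1 (@nat_of_ord _)).
have mid := md i.
rewrite !inordK; try lia.
by move=> e; exists i; lia.
Qed.

Lemma bij_mono_mdeg m : bij_mono m -> ((mdeg m).*2 = d.+1 * d.+2)%N.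
Proof.
move=> bm; have /bij_monoP[mF md mi] := bm.
have -> : mdeg m = (\sum_(k < d.+2) k)%N.
  rewrite mdegE (partition_big (fun i => inord (m i) : 'I_d.+2) predT) //=.
  apply: eq_bigr => k _.
  have [->|k0] := eqVneq k ord0.
    rewrite big1 // => i /eqP /(congr1 (@nat_of_ord _)).
    by rewrite inordK // ltnS.
  have k0' : (0 < k <= d.+1)%N.
    by rewrite lt0n k0 -ltnS ltn_ord.
  have [i mik] := bij_mono_onto bm k0'.
  rewrite (big_pred1 i) // => j; apply/eqP/eqP => [|->].
    move=> /(congr1 (@nat_of_ord _)); rewrite inordK ?ltnS // => mjk.
    by apply: mi; lia.
  by rewrite mik inord_val.
by rewrite -(big_mkord predT id) bin2_sum -mul2n -mul_bin_diag bin1 mulnC.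
Qed.

(** The functional vanishes on m(x_1 + ... + x_n). *)
Lemma wgt_sum m : \sum_i wgt (m + U_(i)) = 0.
Proof.
have [i /= bi|nob] := pickP (fun i => bij_mono (m + U_(i))); last first.
  by rewrite big1 // => i _; rewrite /wgt nob.
have /bij_monoP[iF id ii] := bi.
have [mi0|mi0] := posnP (m i).
  have cm : #|msup m| = d.
    have := subsetP FD _ iF; rewrite inE.
    by rewrite msupDU cardsU1 inE mi0 eqxx => /eqP[].
  have m1 v : m v != 1%N.
    apply/eqP => mv; have := ii i v; rewrite !mnmDU eqxx mi0 mv.
    case: (eqVneq i v) => [iv|_]; first by move: mv; rewrite -iv mi0.
    by move=> /(_ erefl erefl) iv; move: mv; rewrite -iv mi0.
  (* Raising an exponent inside the support leaves only d support vertices; only vertices outside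
     contribute, as in the boundary. *)
  rewrite (bigID (mem (msup m))) /= big1 ?add0r; last first.
    move=> j jm; rewrite /wgt; case: bij_monoP => // -[jF _ _].
    have := subsetP FD _ jF; rewrite inE.
    rewrite msupDU_id; last by move: jm; rewrite inE -lt0n.
    by rewrite cm; lia.
  transitivity ((-1) ^+ minv m * boundary c F (msup m)); last by rewrite cyc ?mulr0.
  rewrite /boundary mulr_sumr.
  apply: eq_big => [j|j jm] //.
  have /eqP mj0 : m j == 0%N by move: jm; rewrite !inE negbK.
  have sj := msupDU m j.
  rewrite /wgt minv_new // sj exprD -mulrA.
  (* Moving the exponent 1 from i to j keeps the exponents distinct and bounded, so only the support
     condition remains. *)
  have -> : bij_mono (m + U_(j)) = (j |: msup m \in F).
    apply/bij_monoP/idP => [[]|jF]; first by rewrite sj.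
    split; first by rewrite sj.
      move=> v; rewrite mnmDU; have := id v; rewrite mnmDU.
      by case: (eqVneq j v) => [<-|_]; [rewrite mj0 | lia].
    move=> u v; rewrite !mnmDU; have := ii u v; rewrite !mnmDU.
    have /eqP mu := m1 u; have /eqP mv := m1 v.
    case: (eqVneq j u) => [<-|ju]; case: (eqVneq j v) => [<-|jv] //;
      rewrite ?mj0; try lia.
    case: (eqVneq i u) => [<-|iu]; case: (eqVneq i v) => [<-|iv] //;
      rewrite ?mi0; lia.
  by case: ifP => _; rewrite ?mulr0.
(* Here [m i] is positive and also occurs at another vertex j; only raising i or j removes this
   collision, and the two signs are opposite. *)
have k1 : (0 < m i <= d.+1)%N.
  by rewrite mi0 /=; have := id i; rewrite mnmDU eqxx; lia.
have [j] := bij_mono_onto bi k1; rewrite mnmDU => mj.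
have ij : i != j by apply/eqP => e; move: mj; rewrite -e eqxx; lia.
rewrite (negPf ij) addn0 in mj.
rewrite (bigD1 i) //= (bigD1 j) 1?eq_sym //= big1 ?addr0; last first.
  move=> v /andP[vi vj]; rewrite /wgt; case: bij_monoP => // -[_ _ vinj].
  have := vinj i j; rewrite !mnmDU (negPf vi) (negPf vj) !addn0 mj.
  by move=> /(_ erefl mi0) e; rewrite e eqxx in ij.
have other v : v != i -> v != j -> m v != m i /\ m v != (m i).+1.
  move=> vi vj; split; apply/eqP => mv.
    have := ii v j; rewrite !mnmDU (eq_sym i v) (negPf vi) (negPf ij) !addn0 mv.
    by rewrite mj => /(_ erefl mi0) e; rewrite e eqxx in vj.
  have := ii v i; rewrite !mnmDU (eq_sym i v) (negPf vi) eqxx addn0 addn1 mv.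
  by move=> /(_ erefl isT) e; rewrite e eqxx in vi.
have bj : bij_mono (m + U_(j)).
  apply/bij_monoP; split; first by rewrite msupDU_id ?mj // -(msupDU_id mi0).
    move=> v; rewrite mnmDU; case: (eqVneq j v) => [<-|_].
      by have := id i; rewrite mnmDU eqxx mj.
    by have := id v; rewrite mnmDU; lia.
  move=> u v; rewrite !mnmDU.
  have Hu := other u; have Hv := other v; have := ii u v; rewrite !mnmDU.
  case: (eqVneq j u) => [<-|ju]; case: (eqVneq j v) => [<-|jv] //.
  - rewrite (negPf ij) mj; case: (eqVneq i v) => [<-|iv]; first by lia.
    have [] := Hv; rewrite 1?eq_sym //; move=> /eqP + /eqP; lia.
  - rewrite (negPf ij) mj; case: (eqVneq i u) => [<-|iu]; first by lia.
    have [] := Hu; rewrite 1?eq_sym //; move=> /eqP + /eqP; lia.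
  - case: (eqVneq i u) => [<-|iu]; case: (eqVneq i v) => [<-|iv] //.
    + have [] := Hv; rewrite 1?eq_sym //; move=> /eqP + /eqP; lia.
    + have [] := Hu; rewrite 1?eq_sym //; move=> /eqP + /eqP; lia.
rewrite /wgt bi bj !msupDU_id ?mj // -mulrDl.
have [lij|lji|/val_inj e] := ltngtP i j; last by rewrite e eqxx in ij.
  by rewrite (minv_swap lij) // exprS mulN1r addNr mul0r.
rewrite (minv_swap lji) ?mj //; first by rewrite exprS mulN1r addrN mul0r.
by move=> v vj vi; exact: other.
Qed.

Lemma wgt_neq0 s : s \in F -> c s != 0 -> exists m, wgt m != 0.
Proof.
(* The vertices of s receive the exponents 1, ..., d + 1 in order of enumeration. *)
move=> sF cs; exists [multinom if i \in s then (index i (enum s)).+1 else 0%N | i < n].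
set m := [multinom _ | i < n].
have ms : msup m = s.
  by apply/setP => i; rewrite inE mnmE; case: ifP.
have sd : size (enum s) = d.+1.
  by rewrite -cardE; have := subsetP FD _ sF; rewrite inE => /eqP.
have bm : bij_mono m.
  apply/bij_monoP; split; first by rewrite ms.
    move=> i; rewrite mnmE; case: ifP => // si.
    by rewrite -sd index_mem mem_enum.
  move=> i j; rewrite !mnmE; case: ifP => // si; case: ifP => // sj [e] _.
  by apply: (@index_inj _ i (enum s) i j _ _ e); rewrite mem_enum.
by rewrite /wgt bm ms mulf_neq0 // signr_eq0.
Qed.

Lemma scaled_wgt (a : 'I_n -> K) : (exists m, wgt m != 0) ->
  exists W : 'X_{1..n} -> K,
    [/\ forall m, W m != 0 -> wgt m != 0, exists m, W m != 0 &
        forall m, \sum_i a i * W (m + U_(i))%MM = 0].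
Proof.
move=> [m0 m0w].
(* Limit of the rescalings by a^-m as the variables with a_i = 0 are given a
   coefficient tending to 0: only the monomials of largest degree in these
   variables survive. *)
pose degZ (m : 'X_{1..n}) := (\sum_(i < n | (a i == 0)%R) m i)%N.
pose P k := asb (exists m, wgt m != 0 /\ degZ m = k).
have exP : exists k, P k by exists (degZ m0); apply/asbP; exists m0.
have ubP k : P k -> (k <= d.+1 * n)%N.
  move=> /asbP[m [mw <-]].
  have bm : bij_mono m by move: mw; rewrite /wgt; case: ifP; rewrite ?eqxx.
  have /bij_monoP[_ md _] := bm.
  rewrite /degZ big_mkcond /=; apply: (@leq_trans (\sum_(i < n) d.+1)%N).
    by apply: leq_sum => i _; case: ifP.
  by rewrite sum_nat_const card_ord mulnC.
case: (ex_maxnP exP ubP) => M /asbP[m1 [m1w m1M]] maxM.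
pose sc (m : 'X_{1..n}) : K := \prod_(i | a i != 0) a i ^- m i.
have sc0 m : sc m != 0.
  by apply/prodf_neq0 => i ai; rewrite invr_neq0 // expf_neq0.
exists (fun m => if degZ m == M then sc m * wgt m else 0); split.
- by move=> m; case: ifP => _; rewrite ?eqxx // mulf_eq0 negb_or => /andP[].
- by exists m1; rewrite m1M eqxx mulf_neq0.
move=> m.
have dZ i : degZ (m + U_(i))%MM = (degZ m + (a i == 0)%R)%N.
  rewrite /degZ (eq_bigr _ (fun j _ => mnmDU m i j)) big_split /=; congr (_ + _)%N.
  rewrite big_mkcond (bigD1 i) //= eqxx big1 ?addn0; last first.
    by move=> j /negPf; rewrite eq_sym => ->; rewrite if_same.
  by case: (_ == _).
have [mM|mM] := eqVneq (degZ m) M; last first.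
  rewrite big1 // => i _; rewrite dZ.
  by have [->|_] := eqVneq (a i) 0; rewrite ?mul0r // addn0 (negPf mM) mulr0.
(* For nonzero a_i the factor a_i cancels the extra inverse in [sc (m + U_(i))]. *)
transitivity (sc m * \sum_i wgt (m + U_(i))); last by rewrite wgt_sum mulr0.
rewrite mulr_sumr; apply: eq_bigr => i _.
rewrite dZ mM; have [ai|ai] := eqVneq (a i) 0.
  rewrite ai mul0r; have [->|wm] := eqVneq (wgt (m + U_(i))) 0; first by rewrite mulr0.
  (* For a_i = 0 a nonzero weight would have degree M + 1 in these variables, against the maximality
     of M. *)
  have : P M.+1 by apply/asbP; exists (m + U_(i))%MM; rewrite dZ mM ai eqxx addn1.
  by move=> /maxM; rewrite ltnn.
rewrite addn0 eqxx mulrA; congr (_ * _).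
rewrite /sc (bigD1 i) //= [RHS](bigD1 i) //= mulrA mnmDU eqxx addn1; congr (_ * _).
  by rewrite exprS invfM mulrA divff // mul1r.
by apply: eq_bigr => j /andP[_ ji]; rewrite mnmDU eq_sym (negPf ji) addn0.
Qed.
End Cycle.

(** * The ideal in terms of monomials *)

(** The monomials outside the ideal, whose classes form a basis of A_Y. *)
Definition allowed (n d : nat) (F : {set {set 'I_n}}) (m : 'X_{1..n}) : bool :=
  [forall i, m i <= d.+1]%N && is_face d F (msup m).

Lemma mcoeffMX_notle (K : fieldType) n (p : {mpoly K[n]}) (k m : 'X_{1..n}) :
  ~~ (k <= m)%MM -> (p * 'X_[k])@_m = 0.
Proof.
move=> km; apply/eqP; rewrite mcoeff_eq0 (perm_mem (msuppMX p k)).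
by apply: contra km => /mapP[m' _ ->]; exact: lem_addr.
Qed.

Lemma xmonE (K : fieldType) n (s : {set 'I_n}) :
  xmon K s = 'X_[[multinom (i \in s : nat) | i < n]].
Proof.
rewrite mpolyXE_id /xmon big_mkcond; apply: eq_bigr => i _ /=.
by rewrite mnmE; case: ifP.
Qed.

Lemma is_face_sub n d (F : {set {set 'I_n}}) (s t : {set 'I_n}) :
  F \subset dfaces n d -> s \subset t -> is_face d F t -> is_face d F s.
Proof.
move=> /subsetP FD st; rewrite /is_face; case: (leqP #|s| d) => //= sd.
move=> /orP[td|tF].
  by rewrite ltnNge (leq_trans (subset_leq_card st) td) in sd.
suff -> : s = t by [].
by apply/eqP; rewrite eqEcard st; have := FD _ tF; rewrite inE => /eqP ->.
Qed.

Lemma IAYP (K : fieldType) n d (F : {set {set 'I_n}}) (f : {mpoly K[n]}) :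
  F \subset dfaces n d ->
  IAY d F f <-> forall m, allowed d F m -> f@_m = 0.
Proof.
move=> FD; split=> [[l [Gl ->]] m /andP[/forallP md mF]|fm].
  rewrite raddf_sum big_seq big1 //= => -[q g] /Gl /= [[s [sF ->]]|[i ->]].
    rewrite xmonE mcoeffMX_notle //; apply: contra sF => /mnm_lepP sm.
    apply: is_face_sub FD _ mF; apply/subsetP => i si; have := sm i.
    by rewrite mnmE si inE lt0n.
  rewrite mpolyXn mcoeffMX_notle //; apply/negP => /mnm_lepP /(_ i).
  by rewrite mulmnE mnm1E eqxx mul1n; have := md i; lia.
(* Each monomial of f is a multiple of one generator: some x_i^(d+2) if an exponent exceeds d + 1,
   otherwise the squarefree monomial of its support, then a non-face. *)
pose sel (m : 'X_{1..n}) : {mpoly K[n]} * {mpoly K[n]} :=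
  if [pick i | (d.+1 < m i)%N] is Some i
  then (f@_m *: 'X_[m - U_(i) *+ d.+2], 'X_i ^+ d.+2)
  else (f@_m *: 'X_[m - [multinom (i \in msup m : nat) | i < n]], xmon K (msup m)).
exists [seq sel m | m <- msupp f]; split.
  move=> _ /mapP[m mf ->]; rewrite /sel; case: pickP => [i mi|md] /=.
    by right; exists i.
  left; exists (msup m); split=> //; apply: contraL mf => mF.
  rewrite -mcoeff_eq0; apply/eqP/fm; rewrite /allowed mF andbT.
  by apply/forallP => i; rewrite leqNgt md.
rewrite big_map [LHS]mpolyE; apply: eq_bigr => m _; rewrite /sel.
case: pickP => [i mi|_] /=; rewrite ?mpolyXn ?xmonE -scalerAl -mpolyXD submK //.
  apply/mnm_lepP => j; rewrite mulmnE mnm1E.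
  by case: (eqVneq i j) => [<-|_]; rewrite ?mul1n ?mul0n.
by apply/mnm_lepP => j; rewrite mnmE inE; case: (m j).
Qed.

Lemma linear_formE (K : fieldType) n (l : {mpoly K[n]}) :
  l \is 1.-homog -> l = \sum_i l@_U_(i) *: 'X_i.
Proof.
move=> lh; apply/mpolyP => m; rewrite raddf_sum /=.
have [/mdeg1P[i /eqP ->]|m1] := boolP (mdeg m == 1%N).
  rewrite (bigD1 i) //= mcoeffZ mcoeffXU eqxx mulr1 big1 ?addr0 // => j ji.
  by rewrite mcoeffZ mcoeffXU (negPf ji) mulr0.
rewrite (dhomog_nemf_coeff lh m1) big1 // => i _; rewrite mcoeffZ mcoeffX.
by case: eqP => [e|_]; rewrite ?mulr0 //; move: m1; rewrite -e mdeg1.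
Qed.

(** * Kernels from cokernels, and functionals on A_Y *)

(** A nonzero w in the right kernel forces the rank below |B|, hence below |A|, so the left kernel
    is nonzero. *)
Lemma kernel_of_cokernel (K : fieldType) (T : finType) (A B : {set T})
    (L : T -> T -> K) (w : T -> K) b0 :
  (#|B| <= #|A|)%N -> b0 \in B -> w b0 != 0 ->
  (forall u, u \in A -> \sum_(v in B) L u v * w v = 0) ->
  exists r : T -> K, (exists2 u, u \in A & r u != 0) /\
    forall v, v \in B -> \sum_(u in A) r u * L u v = 0.
Proof.
move=> BA b0B wb0 Lw.
pose M := \matrix_(i < #|A|, j < #|B|) L (enum_val i) (enum_val j).
pose W := \col_(j < #|B|) w (enum_val j).
have MW : M *m W = 0.
  apply/matrixP => i k; rewrite !mxE -[RHS](Lw (enum_val i)) ?enum_valP //.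
  rewrite [RHS]big_enum_val; apply: eq_bigr => j _.
  by rewrite !mxE.
have rM : (\rank M < #|A|)%N.
  apply: leq_trans BA; rewrite ltn_neqAle rank_leq_col andbT.
  apply/eqP => rk; have /row_fullP[M' M'M] : row_full M by apply/eqP.
  have : W = 0 by rewrite -[W]mul1mx -M'M -mulmxA MW mulmx0.
  move=> /matrixP /(_ (enum_rank_in b0B b0) 0); rewrite !mxE enum_rankK_in //.
  by move=> w0; rewrite w0 eqxx in wb0.
have : kermx M != 0 by rewrite -mxrank_eq0 mxrank_ker; lia.
case/rowV0Pn => v /sub_kermxP vM v0.
have [i vi] : exists i, v 0 i != 0.
  by apply/existsP; apply: contraR v0; rewrite negb_exists => /forallP v0;
     apply/eqP/matrixP => i j; rewrite ord1 mxE; apply/eqP; have := v0 j; rewrite negbK.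
have a0A := enum_valP i.
pose rk := enum_rank_in a0A.
exists (fun u => v 0 (rk u)); split.
  by exists (enum_val i) => //; rewrite /rk enum_valK_in.
move=> b bB; move/matrixP/(_ 0 (enum_rank_in bB b)): vM; rewrite !mxE => vMb.
rewrite -[RHS]vMb big_enum_val; apply: eq_bigr => j _.
by rewrite !mxE /rk enum_valK_in enum_rankK_in.
Qed.

Definition mono (n d : nat) (u : {ffun 'I_n -> 'I_d.+2}) : 'X_{1..n} :=
  [multinom (u i : nat) | i < n].

Lemma mdeg_mono n d (u : {ffun 'I_n -> 'I_d.+2}) : mdeg (mono u) = msum u.
Proof. by rewrite mdegE; apply: eq_bigr => i _; rewrite mnmE. Qed.

Lemma mono_inj n d : injective (@mono n d).
Proof.
by move=> u v /mnmP uv; apply/ffunP => i; have := uv i; rewrite !mnmE => /val_inj.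
Qed.

Lemma allowed_mono n d (F : {set {set 'I_n}}) (u : {ffun 'I_n -> 'I_d.+2}) :
  allowed d F (mono u) = is_face d F (mset u).
Proof.
rewrite /allowed (_ : msup _ = mset u); last first.
  by apply/setP => i; rewrite !inE mnmE.
by case: forallP => // -[] i; rewrite mnmE -ltnS.
Qed.

Lemma allowed_monoP n d (F : {set {set 'I_n}}) m :
  allowed d F m -> exists u : {ffun 'I_n -> 'I_d.+2}, m = mono u.
Proof.
move=> /andP[/forallP md _]; exists [ffun i => inord (m i)].
by apply/mnmP => i; rewrite mnmE ffunE inordK // ltnS.
Qed.

Section Pairing.
Variables (K : fieldType) (n d : nat) (F : {set {set 'I_n}}) (W : 'X_{1..n} -> K).
Hypothesis W_allowed : forall m, W m != 0 -> allowed d F m.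

(** The linear extension of [W]; a finite sum suffices because [W] vanishes on monomials that are
    not allowed. *)
Definition pairing (f : {mpoly K[n]}) : K :=
  \sum_(u : {ffun 'I_n -> 'I_d.+2}) f@_(mono u) * W (mono u).

Lemma pairing_sum (I : Type) (r : seq I) (a : I -> K) (g : I -> {mpoly K[n]}) :
  pairing (\sum_(x <- r) a x *: g x) = \sum_(x <- r) a x * pairing (g x).
Proof.
rewrite /pairing; under [RHS]eq_bigr => x _ do rewrite mulr_sumr.
rewrite exchange_big; apply: eq_bigr => u _ /=.
by rewrite raddf_sum mulr_suml; apply: eq_bigr => x _; rewrite /= mcoeffZ mulrA.
Qed.

Lemma pairingB f g : pairing (f - g) = pairing f - pairing g.
Proof. by rewrite /pairing -sumrB; apply: eq_bigr => u _; rewrite mcoeffB mulrBl. Qed.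

Lemma pairingX m : pairing 'X_[m] = W m.
Proof.
rewrite /pairing; under eq_bigr => u _ do rewrite mcoeffX.
have [Wm|/W_allowed/allowed_monoP[u ->]] := eqVneq (W m) 0.
  by rewrite Wm big1 // => u _; case: eqP => [<-|_]; rewrite ?Wm ?mulr0 ?mul0r.
rewrite (bigD1 u) //= eqxx mul1r big1 ?addr0 // => v vu.
by rewrite (inj_eq (@mono_inj n d)) eq_sym (negPf vu) mul0r.
Qed.

Lemma pairing_mull (l : {mpoly K[n]}) f : l \is 1.-homog ->
  (forall m, \sum_i l@_U_(i) * W (m + U_(i))%MM = 0) -> pairing (l * f) = 0.
Proof.
move=> lh lW; rewrite [f]mpolyE mulr_sumr.
under eq_bigr => m _ do rewrite -scalerAr.
rewrite pairing_sum big1 // => m _.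
rewrite [l]linear_formE // mulr_suml.
under eq_bigr => i _ do rewrite -scalerAl -mpolyXD.
rewrite pairing_sum; under eq_bigr => i _ do rewrite pairingX addmC.
by rewrite lW mulr0.
Qed.

Lemma pairing_IAY f : F \subset dfaces n d -> IAY d F f -> pairing f = 0.
Proof.
move=> FD /(IAYP _ FD) fI; rewrite /pairing big1 // => u _.
have [->|/W_allowed/fI ->] := eqVneq (W (mono u)) 0; by rewrite ?mulr0 ?mul0r.
Qed.
End Pairing.

(** * Failure of the WLP and comparison of probabilities *)

(** [W] depends on the linear form. It excludes surjectivity from degree N to N + 1 and, with the
    dimension inequality, injectivity. *)
Lemma not_WLP_of_functional (K : fieldType) n d (F : {set {set 'I_n}}) N :
  F \subset dfaces n d ->
  (#|face_monos d F N.+1| <= #|face_monos d F N|)%N ->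
  (forall a : 'I_n -> K, exists W : 'X_{1..n} -> K,
    [/\ forall m, W m != 0 -> allowed d F m /\ mdeg m = N.+1,
        exists m, W m != 0 &
        forall m, \sum_i a i * W (m + U_(i))%MM = 0]) ->
  ~ WLP (IAY (K := K) d F).
Proof.
move=> FD cardN HW [D [[_ topD] [l [lh lrank]]]].
have [W [Wsupp [m1 Wm1] lW]] := HW (fun i => l@_U_(i)).
have Wal m : W m != 0 -> allowed d F m by case/Wsupp.
have [m1F m1N] := Wsupp _ Wm1.
(* The monomial [m1] is nonzero in degree N + 1, so the WLP does constrain degree N. *)
have ND : (N < D)%N.
  rewrite ltnNge; apply/negP => DN; apply: (topD N.+1) => //.
  exists 'X_[m1]; split; first by rewrite dhomogX; apply/eqP.
  move=> /(IAYP _ FD) /(_ _ m1F); rewrite mcoeffX eqxx.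
  by apply/eqP; rewrite oner_eq0.
have [linj|lsurj] := lrank N ND; last first.
  have [|f [_ /(pairing_IAY Wal FD)]] := lsurj 'X_[m1]; first by rewrite dhomogX; apply/eqP.
  move=> /eqP; rewrite pairingB.
  by rewrite (pairingX Wal) (pairing_mull Wal) // subr0 (negPf Wm1).
have [u1 m1u] := allowed_monoP m1F.
have u1N : u1 \in face_monos d F N.+1.
  by rewrite inE -allowed_mono -m1u m1F -mdeg_mono -m1u m1N eqxx.
(* The matrix of multiplication by l in the monomial bases; [W] is in its right kernel. *)
pose L (u v : {ffun 'I_n -> 'I_d.+2}) := (l * 'X_[mono u])@_(mono v).
have [||r [[u uN ru] rL]] := @kernel_of_cokernel K _ _ _ L (fun v => W (mono v)) _ cardN u1N.
- by rewrite -m1u.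
- move=> u _; rewrite -[RHS](pairing_mull Wal 'X_[mono u] lh lW) /pairing.
  rewrite [RHS](bigID (mem (face_monos d F N.+1))) /= [X in _ = _ + X]big1 ?addr0 //.
  move=> v; have [->|/Wsupp[vF vN]] := eqVneq (W (mono v)) 0; first by rewrite mulr0.
  by rewrite inE -allowed_mono vF -mdeg_mono vN eqxx.
pose f : {mpoly K[n]} := \sum_(u in face_monos d F N) r u *: 'X_[mono u].
have fh : f \is N.-homog.
  apply: rpred_sum => v; rewrite inE => /andP[_ /eqP vN].
  by apply: dhomogZ; rewrite dhomogX; apply/eqP; rewrite -vN -mdeg_mono.
have fu : f@_(mono u) = r u.
  rewrite raddf_sum (bigD1 u) //= mcoeffZ mcoeffX eqxx mulr1 big1 ?addr0 //.
  move=> v /andP[_ vu].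
  by rewrite mcoeffZ mcoeffX (inj_eq (@mono_inj n d)) (negPf vu) mulr0.
have uF : allowed d F (mono u) by move: uN; rewrite inE -allowed_mono => /andP[].
suff /(linj _ fh)/(IAYP _ FD)/(_ _ uF) : IAY d F (l * f).
  by rewrite fu => ru0; rewrite ru0 eqxx in ru.
apply/(IAYP _ FD) => m mF.
have [mN|mN] := eqVneq (mdeg m) N.+1; last first.
  by apply: dhomog_nemf_coeff mN; rewrite -add1n; apply: dhomogM.
have [v mv] := allowed_monoP mF.
have vN : v \in face_monos d F N.+1.
  by rewrite inE -allowed_mono -mv mF -mdeg_mono -mv mN eqxx.
rewrite -[RHS](rL v vN) mv mulr_sumr raddf_sum; apply: eq_bigr => w _.
by rewrite -scalerAr /= mcoeffZ.
Qed.

Lemma Hd_nonzero_not_WLP (K : fieldType) n d (F : {set {set 'I_n}}) :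
  F \subset dfaces n d -> (n <= d.*2.+1)%N ->
  Hd_nonzero K d F -> ~ WLP (IAY (K := K) d F).
Proof.
move=> FD nd [c [cF [[s cs] cyc]]].
have sF : s \in F by apply: contraNT cs => /cF ->.
have wm := wgt_neq0 FD sF cs.
have wbij m : wgt d F c m != 0 -> bij_mono d F m.
  by rewrite /wgt; case: ifP; rewrite ?eqxx.
have [m0 /wbij/(bij_mono_mdeg FD) m0N] := wm.
(* The degree (d + 1)(d + 2)/2 is read off a monomial of nonzero weight; it is positive, so its
   predecessor is a true N. *)
have hN : ((mdeg m0).-1.+1 = mdeg m0)%N by nia.
apply: (@not_WLP_of_functional K n d F (mdeg m0).-1) => //.
  by apply: leq_card_face_monos => //; rewrite hN.
move=> a; have [W [Ww W0 Wa]] := scaled_wgt FD cyc a wm.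
exists W; split=> // m /Ww/wbij mb; rewrite hN; split; last first.
  by have := bij_mono_mdeg FD mb; lia.
have /bij_monoP[mF md _] := mb.
by rewrite /allowed /is_face mF orbT andbT; apply/forallP.
Qed.

Theorem theorem7p3 (K : fieldType) (R : realType) (s : R) (n d : nat) :
  2^-1 <= s -> s < 1 ->
  (d%:Z = Num.ceil (s * n%:R))%R -> (d < n)%N ->
  forall p : R, 0 < p -> p < 1 ->
  @probY R n d p (fun F => @Hd_nonzero K n d F)
    <= @probY R n d p (fun F => ~ @WLP K n (@IAY K n d F)).
Proof.
move=> s2 s1 dE dn p p0 p1.
(* Since s is at least 1/2, d >= sn >= n/2. *)
have nd : (n <= d.*2.+1)%N.
  have : s * n%:R <= d%:R by have := ceil_ge (s * n%:R); rewrite -dE.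
  have n0 : 0 <= n%:R :> R by [].
  move=> snd; apply: leqW; rewrite -(ler_nat R) -mul2n natrM; nra.
(* One event implies the other, so the sums compare term by term. *)
rewrite /probY [leLHS]big_mkcond [leRHS]big_mkcond; apply: ler_sum => F _.
have P0 : 0 <= p ^+ #|F| * (1 - p) ^+ ('C(n, d.+1) - #|F|).
  by rewrite mulr_ge0 ?exprn_ge0 ?subr_ge0 // ltW.
case FD: (F \subset _) => //=.
case: asbP => [/(Hd_nonzero_not_WLP FD nd) nW|_]; last by case: ifP.
by case: asbP.
Qed.
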